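(* Consider the Polish Algorithm for right duplication $abc{*}{*} = ab{*}cc{*}{*}$ (that is, $a(bc)=(ab)(cc)$). It terminates for every pair of terms $u,v\in\mathbf{T}$ with $\mathrm{depth}(u)\le 6$ and $\mathrm{depth}(v)\le 6$. There exist pairs of terms $u,v\in\mathbf{T}$ with $\mathrm{depth}(u)\le 7$ and $\mathrm{depth}(v)\le 7$ for which it diverges (i.e. never terminates).
   Context: Terms. $\mathbf{T}$ is the set of terms in one variable $x$ and one binary operation symbol $*$ in right Polish notation: it is the smallest set of finite words over the alphabet $\{x,*\}$ with $x \in \mathbf{T}$ and $st* \in \mathbf{T}$ whenever $s,t\in\mathbf{T}$ (the word $st*$ represents the product $s\cdot t$). The depth of a term is its number of occurrences of $x$. A term $v$ is viewed as a word $v(0)v(1)\cdots v(n-1)$ with $n=\mathrm{length}(v)$. First difference. For $u,v\in\mathbf{T}$, $d(u,v)$ is the least $i<\min(\mathrm{length}(u),\mathrm{length}(v))$ with $u(i)\ne v(i)$ if such an $i$ exists, and $d(u,v)=\infty$ otherwise. Dynamic range. Let $d=d(u,v)<\infty$ and $v(d)=*$ (so $u(d)=x$). Then $u$ and $v$ can be written uniquely as $$u = A\,u_0\,u_1\,u_2 * u_3 * \cdots u_n * *\, B,\qquad v = A\,u_0\,u_1 *\, C,$$ where $n\ge 2$, $u_0,\dots,u_n\in\mathbf{T}$, $A,B,C$ are strings, and the first letter of $u_2$ is at position $d$ in $u$ (so the displayed subterm of $u$ is $u_0\cdot((\cdots((u_1\cdot u_2)\cdot u_3)\cdots)\cdot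 u_n)$). Polish Algorithm for right duplication. Given $(u,v)$, stop if $d(u,v)=\infty$. Otherwise let $d=d(u,v)$. If $v(d)=*$, put $v'=v$ and, with the notation above, $$u' = A\,u_0\,u_1 *\, u_2\,u_2 **\, u_3\,u_3 ** \cdots u_n\,u_n **\, B .$$ If $u(d)=*$, put $u'=u$ and define $v'$ analogously with the roles of $u$ and $v$ exchanged. Passing from $(u,v)$ to $(u',v')$ is one step. The algorithm repeats steps; it terminates on $(u,v)$ if after finitely many steps it reaches a pair $(u^*,v^* )$ with $d(u^*,v^* )=\infty$, and diverges otherwise. *)

(* Defs.v *)
From Stdlib Require Export Relation_Operators.
From HB Require Import structures.
From mathcomp Require Export all_boot.

Set Implicit Arguments.
Unset Strict Implicit.
Unset Printing Implicit Defensive.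

Inductive letter : Set := X | Star.

Definition letter_eqb (a b : letter) : bool :=
  match a, b with
  | X, X | Star, Star => true
  | _, _ => false
  end.

Lemma letter_eqP : Equality.axiom letter_eqb.
Proof. by case; case; constructor. Qed.

HB.instance Definition _ := hasDecEq.Build letter letter_eqP.

Definition word : Type := seq letter.

(* Terms are words in right Polish notation: [s ++ t ++ [:: Star]] is s * t. *)
Inductive is_term : word -> Prop :=
| is_term_var : is_term [:: X]
| is_term_mul (s t : word) :
    is_term s -> is_term t -> is_term (s ++ t ++ [:: Star]).

Definition depth (u : word) : nat := count_mem X u.

(* [None] stands for infinity. *)
Definition first_diff (u v : word) : option nat :=
  ohead [seq i <- iota 0 (minn (size u) (size v)) | nth X u i != nth X v i].

(* One right-duplication expansion of [u] against [v], in the case v(d) = Star.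
   The list [us] is u_2, ..., u_n, nonempty because n >= 2; the condition
   [size (A ++ u0 ++ u1) = d] puts the first letter of u_2 at position d. *)
Definition expands (u v u' : word) : Prop :=
  exists (d : nat) (A B C u0 u1 : word) (us : seq word),
    (first_diff u v = Some d /\ nth X v d = Star) /\
    (is_term u0 /\ is_term u1 /\ us <> [::] /\
       (forall t, t \in us -> is_term t)) /\
    size (A ++ u0 ++ u1) = d /\
    u = A ++ u0 ++ u1 ++ flatten [seq t ++ [:: Star] | t <- us]
          ++ [:: Star] ++ B /\
    v = A ++ u0 ++ u1 ++ [:: Star] ++ C /\
    u' = A ++ u0 ++ u1 ++ [:: Star]
           ++ flatten [seq t ++ t ++ [:: Star; Star] | t <- us] ++ B.

Definition polish_step (p q : word * word) : Prop :=
  (expands p.1 p.2 q.1 /\ q.2 = p.2) \/ (expands p.2 p.1 q.2 /\ q.1 = p.1).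

Definition terminates (u v : word) : Prop :=
  exists us vs : word,
    clos_refl_trans (word * word) polish_step (u, v) (us, vs) /\
    first_diff us vs = None.

(* On terms the decomposition in [expands] exists and is unique, so
   [polish_step] is deterministic and gets stuck only when the first
   difference is infinite. *)
Definition diverges (u v : word) : Prop := ~ terminates u v.

(* Main.v *)
Require Import Defs.

Set Implicit Arguments.
Unset Strict Implicit.
Unset Printing Implicit Defensive.

(** Suppose the terms are [P ++ X :: u] and [P ++ Star :: v].  Read on a stack
    of completed subterms, [X :: u] splits uniquely into [u_2, ..., u_n] and the
    unused rest [B], so one step of the algorithm is deterministic and merely
    rewrites the tail [X :: u].  Termination in depth at most 6 is thus a finite
    computation.  In depth 7, two steps lead from [xx*xx*xx*x***] and
    [xxx*x*xx*x***] to words with tails [x*xx*x***] and [*xx*x*xx*x***] behind a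
    common prefix.  The second tail is [*xx*] followed by the first, and a step
    turns the first tail into [*xx*] followed by the second: up to the prefix,
    each step exchanges the two tails. *)

Definition mul (s t : word) : word := s ++ t ++ [:: Star].

Definition all_terms (ts : seq word) : Prop := {in ts, forall t, is_term t}.

Definition stack_word (st : seq word) : word := flatten (rev st).

Lemma stack_word_cons t st : stack_word (t :: st) = stack_word st ++ t.
Proof. by rewrite /stack_word rev_cons flatten_rcons. Qed.

Definition read_letter (st : seq word) (a : letter) : option (seq word) :=
  match a, st with
  | X, _ => Some ([:: X] :: st)
  | Star, t :: s :: st' => Some (mul s t :: st')
  | Star, _ => None
  end.

Lemma read_letter_all_terms st a st' :
  read_letter st a = Some st' -> all_terms st -> all_terms st'.
Proof.
case: a st => [st|[|t [|s st]]] //= [<-].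
  by move=> st_terms; apply/forall_cons; split=> //; exact: is_term_var.
case/forall_cons=> t_term /forall_cons [s_term st_terms].
by apply/forall_cons; split=> //; exact: is_term_mul.
Qed.

Lemma stack_word_read_letter st a st' :
  read_letter st a = Some st' -> stack_word st' = stack_word st ++ [:: a].
Proof.
by case: a st => [st|[|t [|s st]]] //= [<-]; rewrite !stack_word_cons -?catA.
Qed.

Definition starred (us : seq word) : word :=
  flatten [seq t ++ [:: Star] | t <- us].

Definition duplicated (us : seq word) : word :=
  flatten [seq t ++ t ++ [:: Star; Star] | t <- us].

(* A star that cannot be read on [st] completes the single term left there as
   one of the [us]; on an empty stack it is the star that precedes [B]. *)
Fixpoint split_starred (st : seq word) (r : word) : option (seq word * word) :=
  if r is a :: r' then
    if read_letter st a is Some st' then split_starred st' r' else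
    if st is t :: _ then
      omap (fun usB => (t :: usB.1, usB.2)) (split_starred [::] r')
    else Some ([::], r')
  else None.

Lemma split_starred_sound st r us B :
  all_terms st -> split_starred st r = Some (us, B) ->
  all_terms us /\ stack_word st ++ r = starred us ++ Star :: B.
Proof.
elim: r st us B => [//|a r IH] st us B st_terms /=.
case read_a: (read_letter st a) => [st'|].
  case/(IH _ _ _ (read_letter_all_terms read_a st_terms)) => us_terms <-.
  by rewrite (stack_word_read_letter read_a) -catA.
case: a read_a => //; case: st st_terms => [|t [|s st]] //= st_terms _.
  by case=> <- <-.
case split_r: (split_starred [::] r) => [[us' B']|] //= [<- <-].
have [// | us'_terms /= ->] := IH _ _ _ _ split_r.
split; last by rewrite /stack_word /starred /= cats0 -!catA.
by apply/forall_cons; case/forall_cons: st_terms.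
Qed.

Lemma split_starred_term t st r :
  is_term t -> split_starred st (t ++ r) = split_starred (t :: st) r.
Proof.
move=> t_term; elim: t_term st r => {t} [//|s t _ IHs _ IHt] st r.
by rewrite -!catA IHs IHt.
Qed.

Lemma split_starred_complete us B :
  all_terms us -> split_starred [::] (starred us ++ Star :: B) = Some (us, B).
Proof.
elim: us => [//|t us IH] /forall_cons [t_term us_terms].
by rewrite /starred /= -!catA split_starred_term //= IH.
Qed.

Definition expand_tail (r : word) : option word :=
  omap (fun usB => Star :: duplicated usB.1 ++ usB.2) (split_starred [::] r).

Lemma first_diff_cons a b u v :
  first_diff (a :: u) (b :: v) =
  if a != b then Some 0 else omap succn (first_diff u v).
Proof.
rewrite /first_diff /= minnSS /=; case: eqP => //= _.
rewrite -[1]addn0 iotaDl filter_map /=.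
rewrite (@eq_filter _ _ (fun i => nth X u i != nth X v i)) //.
by case: filter.
Qed.

Lemma first_diff_cat P u v :
  first_diff (P ++ u) (P ++ v) = omap (addn (size P)) (first_diff u v).
Proof.
elim: P => [|c P IH] /=; first by case: first_diff.
by rewrite first_diff_cons eqxx IH; case: first_diff.
Qed.

Lemma first_diff_cat_neq P a b u v :
  a != b -> first_diff (P ++ a :: u) (P ++ b :: v) = Some (size P).
Proof.
by move=> neq_ab; rewrite first_diff_cat first_diff_cons neq_ab /= addn0.
Qed.

Lemma first_diff_prefix P v : first_diff P (P ++ v) = None.
Proof. by rewrite -{1}[P]cats0 first_diff_cat /first_diff min0n. Qed.

Lemma first_diff_sym u v : first_diff u v = first_diff v u.
Proof.
rewrite /first_diff minnC; congr ohead.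
by apply: eq_filter => i; rewrite eq_sym.
Qed.

Definition ends_with_two_terms (P : word) : Prop :=
  exists A s t, [/\ is_term s, is_term t & P = A ++ s ++ t].

Lemma stack_ends_with_two_terms st :
  all_terms st -> 1 < size st -> ends_with_two_terms (stack_word st).
Proof.
case: st => [|t [|s st]] // /forall_cons [t_term /forall_cons [s_term _]] _.
by exists (stack_word st), s, t; rewrite !stack_word_cons catA.
Qed.

Lemma expands_X_StarP P u v w :
  expands (P ++ X :: u) (P ++ Star :: v) w <->
  ends_with_two_terms P /\
  exists2 r, expand_tail (X :: u) = Some r & w = P ++ r.
Proof.
split=> [[d [A [B [C [s [t [us []]]]]]]]|].
  rewrite first_diff_cat_neq // => -[[<-] _] [[s_term [t_term [_ us_terms]]]].
  case=> size_P [split_u [_ ->]].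
  have regroup z : A ++ s ++ t ++ z = (A ++ s ++ t) ++ z by rewrite -!catA.
  move: split_u; rewrite !regroup => /eqP; rewrite eqseq_cat //.
  case/andP=> /eqP EP /eqP Eu; rewrite -EP; split; first by exists A, s, t.
  exists (Star :: duplicated us ++ B) => //.
  by rewrite /expand_tail Eu (split_starred_complete _ us_terms).
case=> -[A [s [t [s_term t_term ->]]]] [r].
rewrite /expand_tail; case split_u: split_starred => [[us B]|] //= [<-] ->.
have [// | us_terms /= Eu] := split_starred_sound _ split_u.
have us_neq0 : us <> [::] by move=> us0; rewrite us0 in Eu.
exists (size (A ++ s ++ t)), A, B, v, s, t, us.
by rewrite first_diff_cat_neq // nth_cat ltnn subnn Eu -!catA.
Qed.

Lemma not_expands_Star_X P u v w :
  ~ expands (P ++ Star :: u) (P ++ X :: v) w.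
Proof.
case=> d [A [B [C [s [t [us [[]]]]]]]].
by rewrite first_diff_cat_neq // => -[<-]; rewrite nth_cat ltnn subnn.
Qed.

Lemma polish_step_X_StarP P u v r q :
  expand_tail (X :: u) = Some r ->
  polish_step (P ++ X :: u, P ++ Star :: v) q <->
  ends_with_two_terms P /\ q = (P ++ r, P ++ Star :: v).
Proof.
move=> tail_r; split=> [[] [] /=|[P_ends ->]].
- case/expands_X_StarP=> P_ends [r']; rewrite tail_r => -[<-] Eq1 Eq2.
  by rewrite -Eq1 -Eq2; case: q {Eq1 Eq2}.
- by move/not_expands_Star_X.
by left; split=> //; apply/expands_X_StarP; split=> //; exists r.
Qed.

Lemma polish_step_swap p q :
  polish_step p q -> polish_step (swap_pair p) (swap_pair q).
Proof. by case; [right | left]. Qed.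

Lemma terminates_sym u v : terminates u v -> terminates v u.
Proof.
case=> us [vs [run diff]]; exists vs, us; rewrite first_diff_sym; split=> //.
have swap_run p q : clos_refl_trans _ polish_step p q ->
    clos_refl_trans _ polish_step (swap_pair p) (swap_pair q).
  elim=> {p q} [p q step_pq|p|p q r _ run_pq _ run_qr].
  - exact/rt_step/polish_step_swap.
  - exact: rt_refl.
  - exact: rt_trans run_pq run_qr.
exact: swap_run run.
Qed.

Lemma diverges_sym u v : diverges u v -> diverges v u.
Proof. by move=> div_uv /terminates_sym. Qed.

Lemma terminates_refl u v : first_diff u v = None -> terminates u v.
Proof. by move=> diff; exists u, v; split=> //; exact: rt_refl. Qed.

Lemma terminates_step p q :
  polish_step p q -> terminates q.1 q.2 -> terminates p.1 p.2.
Proof.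
case: p q => [u v] [u' v'] step_pq [us [vs [run diff]]].
exists us, vs; split=> //.
exact: rt_trans (rt_step _ _ _ _ step_pq) run.
Qed.

Lemma terminates_expand_tail P u v r :
  ends_with_two_terms P -> expand_tail (X :: u) = Some r ->
  terminates (P ++ r) (P ++ Star :: v) ->
  terminates (P ++ X :: u) (P ++ Star :: v).
Proof.
move=> P_ends tail_r.
apply: (@terminates_step (_, _) (_, _)).
by apply/(polish_step_X_StarP _ _ _ tail_r).
Qed.

Lemma diverges_invariant (I : word * word -> Prop) :
  (forall p, I p -> first_diff p.1 p.2 <> None) ->
  (forall p q, I p -> polish_step p q -> I q) ->
  forall u v, I (u, v) -> diverges u v.
Proof.
move=> I_diff I_step u v I_uv [us [vs [run diff]]].
suff /I_diff : I (us, vs) by [].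
elim: run I_uv => [p q step_pq I_p|p //|p q r _ I_pq _ I_qr /I_pq/I_qr //].
exact: I_step I_p step_pq.
Qed.

Lemma diverges_expand_tail P u v r :
  expand_tail (X :: u) = Some r ->
  diverges (P ++ r) (P ++ Star :: v) -> diverges (P ++ X :: u) (P ++ Star :: v).
Proof.
move=> tail_r div_r.
pose I p := p = (P ++ X :: u, P ++ Star :: v) \/ diverges p.1 p.2.
apply: (@diverges_invariant I); last by left.
- by move=> p [-> | div_p /terminates_refl //]; rewrite first_diff_cat_neq.
- move=> p q [-> /(polish_step_X_StarP _ _ _ tail_r) [_ ->] | div_p step_pq].
    by right.
  by right=> /(terminates_step step_pq).
Qed.

Lemma swapped_tails_diverge (s u v : word) :
  Star :: v = s ++ X :: u -> expand_tail (X :: u) = Some (s ++ Star :: v) ->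
  forall P, diverges (P ++ X :: u) (P ++ Star :: v).
Proof.
move=> Ev tail_u P.
pose I p := exists Q, p = (Q ++ X :: u, Q ++ Star :: v) \/
                      p = (Q ++ Star :: v, Q ++ X :: u).
have I_step Q q :
    polish_step (Q ++ X :: u, Q ++ Star :: v) q -> I q /\ I (swap_pair q).
  case/(polish_step_X_StarP _ _ _ tail_u) => _ ->.
  by rewrite {2 4}Ev !catA; split; exists (Q ++ s); [right | left].
apply: (@diverges_invariant I); last by exists P; left.
- by move=> p [Q [->|->]]; rewrite first_diff_cat_neq.
- move=> p q [Q [-> /I_step [] //|-> /polish_step_swap /I_step []]].
  by rewrite swap_pairK.
Qed.

(* [stack_word st] is the common prefix already read, [u] and [v] are the
   remaining tails; reading a letter costs fuel just as a step does. *)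
Fixpoint halts_within (n : nat) (st : seq word) (u v : word) : bool :=
  if n is n'.+1 then
    match u, v with
    | [::], _ | _, [::] => true
    | X :: u', X :: v' => halts_within n' ([:: X] :: st) u' v'
    | Star :: u', Star :: v' =>
        if read_letter st Star is Some st' then halts_within n' st' u' v'
        else false
    | X :: _, Star :: _ =>
        if expand_tail u is Some u' then
          (1 < size st) && halts_within n' st u' v
        else false
    | Star :: _, X :: _ =>
        if expand_tail v is Some v' then
          (1 < size st) && halts_within n' st u v'
        else false
    end
  else false.

Lemma halts_within_terminates n st u v :
  all_terms st -> halts_within n st u v ->
  terminates (stack_word st ++ u) (stack_word st ++ v).
Proof.
elim: n st u v => [//|n IH] st [|a u] [|b v] st_terms.
1-3: move=> _; rewrite cats0.
- by apply: terminates_refl; rewrite -{2}[stack_word st]cats0 first_diff_prefix.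
- exact/terminates_refl/first_diff_prefix.
- exact/terminates_sym/terminates_refl/first_diff_prefix.
have read_common c st' :
    read_letter st c = Some st' -> halts_within n st' u v ->
    terminates (stack_word st ++ c :: u) (stack_word st ++ c :: v).
  move=> read_c /(IH _ _ _ (read_letter_all_terms read_c st_terms)).
  by rewrite (stack_word_read_letter read_c) -!catA.
case: a b => [] [].
- exact: (read_common X).
- rewrite /halts_within -/halts_within.
  case tail_u: expand_tail => [r|] // /andP [size_st halts_r].
  apply: terminates_expand_tail tail_u (IH _ _ _ st_terms halts_r).
  exact: stack_ends_with_two_terms.
- rewrite /halts_within -/halts_within.
  case tail_v: expand_tail => [r|] // /andP [size_st halts_r].
  apply/terminates_sym/(terminates_expand_tail _ tail_v).
    exact: stack_ends_with_two_terms.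
  exact/terminates_sym/IH.
- rewrite /halts_within -/halts_within.
  by case read_star: read_letter => [st'|] //; exact: read_common.
Qed.

Fixpoint terms_upto (n : nat) : seq word :=
  if n is n'.+1 then
    [:: X] :: [seq t <- allpairs mul (terms_upto n') (terms_upto n')
              | depth t <= n]
  else [::].

Lemma depth_mul s t : depth (mul s t) = depth s + depth t.
Proof. by rewrite /depth !count_cat /= !addn0. Qed.

Lemma depth_gt0 t : is_term t -> 0 < depth t.
Proof.
by elim=> [//|s {}t _ depth_s _ _]; rewrite depth_mul addn_gt0 depth_s.
Qed.

Lemma mem_terms_upto n t : is_term t -> depth t <= n -> t \in terms_upto n.
Proof.
move=> t_term; elim: t_term n => {t} [|s t s_term IHs t_term IHt] [|n] //.
  by rewrite depth_mul leqn0 addn_eq0 eqn0Ngt depth_gt0.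
move=> depth_st; rewrite inE mem_filter depth_st /=; apply/orP; right.
move: depth_st; rewrite depth_mul => depth_st.
apply/allpairsP; exists (s, t); split=> //=.
- apply/IHs; rewrite -ltnS (leq_trans _ depth_st) //.
  by rewrite -addn1 leq_add2l depth_gt0.
- apply/IHt; rewrite -ltnS (leq_trans _ depth_st) //.
  by rewrite -add1n leq_add2r depth_gt0.
Qed.

Lemma terms_upto6_halt : all2rel (halts_within 100 [::]) (terms_upto 6).
Proof. by vm_compute. Qed.

Definition divergent_left : word :=
  let xx := mul [:: X] [:: X] in mul xx (mul xx (mul xx [:: X])).

Definition divergent_right : word :=
  let xxx := mul (mul [:: X] [:: X]) [:: X] in mul [:: X] (mul xxx xxx).

Lemma divergent_left_right : diverges divergent_left divergent_right.
Proof.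
apply: diverges_sym; apply: (@diverges_expand_tail [:: X; X]); first by [].
apply: diverges_sym.
apply: (@diverges_expand_tail [:: X; X; Star; X; X; Star]); first by [].
by apply: (@swapped_tails_diverge [:: Star; X; X; Star] _ _ _ _
             [:: X; X; Star; X; X; Star; Star; X; X; Star]).
Qed.

Theorem theorem5 :
  (forall u v : word, is_term u -> is_term v ->
     depth u <= 6 -> depth v <= 6 -> terminates u v) /\
  (exists u v : word,
     is_term u /\ is_term v /\ depth u <= 7 /\ depth v <= 7 /\ diverges u v).
Proof.
split=> [u v u_term v_term depth_u depth_v|].
  apply: (@halts_within_terminates 100 [::]) => //.
  by apply: (allrelP terms_upto6_halt); exact: mem_terms_upto.
exists divergent_left, divergent_right; split; first by do !constructor.
split; first by do !constructor.
by do !split=> //; exact: divergent_left_right.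
Qed.
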